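(* Let $0\le p<m$ and let $\omega$ be a smooth differential form of degree $p$ on $\mathbb R^m$ satisfying $$d*\left(\frac{d\omega}{\sqrt{1+|d\omega|^2}}\right)=\xi,$$ where $\xi$ is a differential form of degree $m-p$ on $\mathbb R^m$. Suppose there exists an $(m-p)$-plane $\Sigma$ in $\mathbb R^m$, with volume element $d\Sigma$, such that $\xi|_\Sigma=g(x)\,d\Sigma$ off a bounded set $K$ in $\Sigma$, where $g$ is a continuous function on $\Sigma\backslash K$ with $c=\inf_{x\in\Sigma\backslash K}|g(x)|$. Then $c=0$.
   Context: $*$ is the Hodge star operator of the Euclidean metric on $\mathbb R^m$, and $|\cdot|$ is the pointwise Euclidean norm of differential forms, for which the forms $dx_{j_1}\wedge\cdots\wedge dx_{j_k}$, $j_1<\cdots<j_k$, are orthonormal. $\xi|_\Sigma$ denotes the pullback of $\xi$ under the inclusion $\Sigma\hookrightarrow\mathbb R^m$. *)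

(* Defs.v *)
From HB Require Import structures.
From mathcomp Require Import all_boot all_order all_algebra.
From mathcomp Require Import all_classical all_reals all_analysis.

Set Implicit Arguments.
Unset Strict Implicit.
Unset Printing Implicit Defensive.

Import Order.TTheory GRing.Theory Num.Theory.
Import numFieldNormedType.Exports.

Local Open Scope ring_scope.

(* An element a of the exterior algebra of the dual of R^m is given by its
   coordinates: a I is the coefficient of dx_{i_1} /\ ... /\ dx_{i_k}, where
   i_1 < ... < i_k are the elements of I. All degrees live in the same type,
   so that d and * need no casts between degrees. *)
Notation extalg R m := {ffun {set 'I_m} -> R}.

Definition dform (R : realType) (m : nat) := 'rV[R]_m -> extalg R m.

Section ExteriorAlgebra.
Variables (R : realType) (m : nat).
Implicit Types (a b : extalg R m) (I J : {set 'I_m}).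

Definition of_degree (k : nat) a := forall I, #|I| != k -> a I = 0.

Definition dxs I : extalg R m := [ffun J => (J == I)%:R].

(* For disjoint I and J, the sign of the permutation sorting the elements of I
   (in increasing order) followed by those of J. *)
Definition shuffle_sign I J : R :=
  (-1) ^+ #|[set ij : 'I_m * 'I_m |
              [&& ij.1 \in I, ij.2 \in J & (ij.2 < ij.1)%N]]%SET|.

Definition wedge a b : extalg R m :=
  [ffun J : {set 'I_m} =>
    \sum_(I : {set 'I_m} | I \subset J)
      shuffle_sign I (J :\: I) * a I * b (J :\: I)].

Definition ext_dot a b : R := \sum_I a I * b I.

Definition ext_norm a : R := Num.sqrt (ext_dot a a).

(* The Hodge star of the Euclidean metric and the standard orientation:
   *dx_I = shuffle_sign I (~: I) dx_(~: I), so that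
   a /\ *b = <a, b> dx_1 /\ ... /\ dx_m for a and b of the same degree. *)
Definition hodge a : extalg R m :=
  [ffun J : {set 'I_m} => shuffle_sign (~: J) J * a (~: J)].

Lemma wedge_hodge (k : nat) a b : of_degree k a -> of_degree k b ->
  wedge a (hodge b) = ext_dot a b *: dxs [set: 'I_m]%SET.
Proof.
move=> ak bk; apply/ffunP => J; rewrite !ffunE.
have [->|JT] := eqVneq J [set: 'I_m]%SET; last first.
  rewrite mulr0n scaler0 big1// => I IJ; rewrite ffunE.
  have [Ik|/ak->] := eqVneq #|I| k; last by rewrite mulr0 mul0r.
  rewrite bk ?mulr0//; apply: contra JT => /eqP e.
  have := cardsC (J :\: I); rewrite e cardsD (finset.setIidPr IJ) Ik => cJ.
  rewrite eqEcard finset.subsetT cardsT -cJ subnK ?leqnn// -Ik.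
  exact: subset_leq_card.
rewrite [RHS]mulr1; apply: eq_big => [I|I _]; first exact: finset.subsetT.
rewrite ffunE finset.setTD finset.setCK mulrACA.
rewrite [X in X * _](_ : _ = 1) ?mul1r//.
by rewrite -expr2 sqrr_sign.
Qed.

(* Evaluation of the degree k part of a on the k vectors given by the rows of V,
   with the convention
   (dx_{i_1} /\ ... /\ dx_{i_k}) (v_1, ..., v_k) = det (dx_{i_s} v_r). *)
Definition ext_eval (k : nat) a (V : 'M[R]_(k, m)) : R :=
  \sum_(f : {ffun 'I_k -> 'I_m} |
      [forall i : 'I_k, forall j : 'I_k, (i < j)%N ==> (f i < f j)%N])
    a [set f i | i : 'I_k]%SET * \det (colsub f V).

End ExteriorAlgebra.

Section Calculus.
Variables (R : realType) (m : nat).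

Definition partial (i : 'I_m) (f : 'rV[R]_m -> R) : 'rV[R]_m -> R :=
  fun x => 'D_(delta_mx 0 i) f x.

Definition smooth (f : 'rV[R]_m -> R) :=
  forall s : seq 'I_m,
    let h := foldr partial f s in
    continuous h /\ forall (i : 'I_m) x, derivable h x (delta_mx 0 i).

Definition smooth_form (w : dform R m) :=
  forall I : {set 'I_m}, smooth (fun x => w x I).

(* d w = \sum_i dx_i /\ (partial_i w) *)
Definition ext_d (w : dform R m) : dform R m := fun x =>
  \sum_(i < m)
    wedge (dxs R [set i]%SET)
      [ffun I : {set 'I_m} => partial i (fun y => w y I) x].

End Calculus.

Section Planes.
Local Open Scope classical_set_scope.
Variables (R : realType) (m q : nat).

Definition orthonormal_rows (E : 'M[R]_(q, m)) := E *m E^T = 1%:M.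

Definition affine_plane (a : 'rV[R]_m) (E : 'M[R]_(q, m)) : set 'rV[R]_m :=
  [set a + u *m E | u in [set: 'rV[R]_q]].

(* For E orthonormal, the volume element of the plane directed by E, oriented
   by E, evaluated on q tangent vectors (the rows of V). *)
Definition volume_element (E V : 'M[R]_(q, m)) : R := \det (V *m E^T).

(* At the point x, the pullback of w to the plane directed by E is c times the
   volume element: both agree on all q-tuples of tangent vectors. *)
Definition pullback_eq (E : 'M[R]_(q, m)) (w : dform R m) (c : R)
    (x : 'rV[R]_m) :=
  forall V : 'M[R]_(q, m), (V <= E)%MS ->
    ext_eval (w x) V = c * volume_element E V.

End Planes.

(* Main.v *)
Require Import Defs.
From HB Require Import structures.
From mathcomp Require Import all_boot all_order all_algebra.
From mathcomp Require Import all_classical all_reals all_analysis.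
From mathcomp Require Import ring.

Set Implicit Arguments.
Unset Strict Implicit.
Unset Printing Implicit Defensive.

Import Order.TTheory GRing.Theory Num.Theory.
Import numFieldNormedType.Exports.

Local Open Scope classical_set_scope.
Local Open Scope ring_scope.

(** Write q = m - p and eta = * (d omega / sqrt (1 + |d omega|^2)), so that the
    equation reads d eta = xi. However large omega is, every coefficient of eta
    lies in [-1, 1]. If |g| were at least c > 0 far out on the plane, then on a
    cube of side L of the plane, chosen beyond K, the function g would keep a
    constant sign, and the integral of d eta over that cube would have absolute
    value at least c L^q. By Stokes it is the flux of the bounded form eta
    through the boundary, hence O(L^(q-1)): a contradiction for large L.

    Two points keep the argument elementary.

    - On the constant frame E_0, ..., E_(q-1) of the plane,
      d eta (E_0, ..., E_(q-1)) is the sum over r of the derivative along E_r of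
      F_r = (-1)^r eta (E_0, .., E_r omitted, .., E_(q-1)). It is a divergence
      (ext_eval_ext_d); behind this is the fact that evaluating dx_i /\ b on a
      frame expands a determinant along a column (ext_eval_wedge).

    - Stokes' theorem on a cube is replaced by a summation over a grid of step
      h (flux_bound). Continuously differentiable functions are strictly
      differentiable (strict_derive_C1), so by compactness the sum over r of the
      differences F_r (y + h E_r) - F_r y is at least h c at every grid point y
      once h is small (uniform_flux), while the sum of these differences over
      the grid telescopes to boundary terms (grid_telescope). *)

(** * Evaluating dx_i /\ b on a frame *)
Section Evaluation.
Variables (R : realType) (m : nat).
Implicit Types (a b : extalg R m) (I J : {set 'I_m}).

Definition increasing k (f : {ffun 'I_k -> 'I_m}) :=
  [forall i : 'I_k, forall j : 'I_k, (i < j)%N ==> (f i < f j)%N].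

Lemma increasingP k (f : {ffun 'I_k -> 'I_m}) :
  reflect {homo f : i j / (i < j)%N} (increasing f).
Proof.
apply: (iffP forallP) => [h i j ij|h i].
  by have /forallP/(_ j)/implyP := h i; exact.
by apply/forallP => j; apply/implyP; exact: h.
Qed.

Lemma increasing_inj k (f : {ffun 'I_k -> 'I_m}) : increasing f -> injective f.
Proof.
move=> /increasingP h i j fij.
have [/h|/h|/val_inj//] := ltngtP i j; by rewrite fij ltnn.
Qed.

Lemma card_increasing k (f : {ffun 'I_k -> 'I_m}) : increasing f ->
  #|[set f i | i : 'I_k]%SET| = k.
Proof. by move=> /increasing_inj fi; rewrite card_imset// card_ord. Qed.

(** Both functions list the elements of the same set in increasing order. *)
Lemma increasing_uniq k (f g : {ffun 'I_k -> 'I_m}) :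
  increasing f -> increasing g ->
  [set f i | i : 'I_k]%SET = [set g i | i : 'I_k]%SET -> f = g.
Proof.
move=> fI gI fg.
pose s (f : {ffun 'I_k -> 'I_m}) := [seq f i | i <- enum 'I_k].
have ss h : increasing h -> sorted (relpre val ltn) (s h).
  move=> /increasingP hI; rewrite sorted_map.
  apply: (@sub_sorted _ (relpre val ltn)); first by move=> i j; exact: hI.
  by rewrite -sorted_map val_enum_ord iota_ltn_sorted.
have sE h x : (x \in s h) = (x \in [set h i | i : 'I_k]%SET).
  apply/mapP/imsetP => -[i _ ->]; exists i => //; exact: mem_enum.
have : s f = s g.
  apply: (irr_sorted_eq _ _ (ss _ fI) (ss _ gI)).
  - by move=> x y z; exact: ltn_trans.
  - by move=> x /=; rewrite ltnn.
  - by move=> x; rewrite !sE fg.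
by move=> e; apply/ffunP => i; move/eq_in_map: e; apply; exact: mem_enum.
Qed.

Lemma increasing_ex k J : #|J| = k ->
  exists2 f : {ffun 'I_k -> 'I_m}, increasing f & [set f i | i : 'I_k]%SET = J.
Proof.
move=> <-; exists [ffun i => enum_val i].
  apply/increasingP => i j ij; rewrite !ffunE.
  have x0 : 'I_m by exact: enum_val i.
  rewrite !(enum_val_nth x0).
  have : sorted (relpre val ltn) (enum J).
    rewrite -(@sorted_map _ _ val ltn).
    apply: (@subseq_sorted _ _ _ _ (map val (enum 'I_m))).
    - exact: ltn_trans.
    - by apply: map_subseq; rewrite enumT; exact: filter_subseq.
    - by rewrite val_enum_ord iota_ltn_sorted.
  have tr : transitive (relpre (@nat_of_ord m) ltn).
    by move=> x y z; exact: ltn_trans.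
  by move=> /(sorted_ltn_nth tr x0); apply; rewrite ?inE -?cardE.
apply/setP => x; apply/imsetP/idP => [[i _ ->]|xJ].
  by rewrite ffunE enum_valP.
by exists (enum_rank_in xJ x); rewrite // ffunE enum_rankK_in.
Qed.

Lemma ext_eval_sum (T : finType) k (c : T -> R) (e : T -> extalg R m)
    (V : 'M[R]_(k, m)) :
  ext_eval (\sum_t c t *: e t) V = \sum_t c t * ext_eval (e t) V.
Proof.
rewrite /ext_eval; under [RHS]eq_bigr do rewrite mulr_sumr.
rewrite exchange_big; apply: eq_bigr => f _.
rewrite sum_ffunE mulr_suml; apply: eq_bigr => t _.
by rewrite ffunE mulrA.
Qed.

Lemma ext_evalZ k (c : R) a (V : 'M[R]_(k, m)) :
  ext_eval (c *: a) V = c * ext_eval a V.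
Proof.
rewrite /ext_eval mulr_sumr; apply: eq_bigr => f _.
by rewrite ffunE mulrA.
Qed.

(** The evaluation formulas are bilinear, so this decomposition reduces them to
    basis forms. *)
Lemma extalg_dxs a : a = \sum_I a I *: dxs R I.
Proof.
apply/ffunP => J; rewrite sum_ffunE (bigD1 J)//= big1 ?addr0.
  by rewrite !ffunE eqxx [RHS]mulr1.
by move=> I IJ; rewrite !ffunE eq_sym (negbTE IJ) [LHS]mulr0.
Qed.

Lemma ext_eval_dxs_deg k I (V : 'M[R]_(k, m)) : #|I| <> k ->
  ext_eval (dxs R I) V = 0.
Proof.
move=> Ik; apply: big1 => f /card_increasing fk.
rewrite ffunE; case: eqP => [e|]; last by rewrite mul0r.
by case: Ik; rewrite -e.
Qed.

Lemma ext_eval_dxs k (f : {ffun 'I_k -> 'I_m}) (V : 'M[R]_(k, m)) :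
  increasing f ->
  ext_eval (dxs R [set f i | i : 'I_k]%SET) V = \det (colsub f V).
Proof.
move=> fI; rewrite /ext_eval (bigD1 f)//= ffunE eqxx mul1r big1 ?addr0//.
move=> g /andP[gI gf]; rewrite ffunE; case: eqP => [e|]; last by rewrite mul0r.
by case/eqP: gf; exact: increasing_uniq.
Qed.

Lemma wedge_dxs_suml i b :
  wedge (dxs R [set i]%SET) b =
  \sum_I b I *: wedge (dxs R [set i]%SET) (dxs R I).
Proof.
apply/ffunP => J; rewrite sum_ffunE ffunE.
under [RHS]eq_bigr do rewrite !ffunE /GRing.scale/= mulr_sumr.
rewrite exchange_big/=; apply: eq_bigr => S SJ.
rewrite (bigD1 (J :\: S)%SET)//= big1 ?addr0.
  by rewrite !ffunE eqxx mulr1 mulrC.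
by move=> I IJ; rewrite !ffunE (eq_sym _ I) (negbTE IJ) !mulr0.
Qed.

Lemma wedge_dxs i I :
  wedge (dxs R [set i]%SET) (dxs R I) =
  if i \in I then 0
  else (-1) ^+ #|[set j in I | (j < i)%N]%SET| *: dxs R (i |: I)%SET.
Proof.
apply/ffunP => J; rewrite ffunE.
have -> : \sum_(S : {set 'I_m} | S \subset J)
    shuffle_sign R S (J :\: S) * dxs R [set i]%SET S * dxs R I (J :\: S)%SET =
    if (i \in J) && (J :\ i == I)%SET then shuffle_sign R [set i]%SET I else 0.
  have [iJ|iJ] /= := boolP (i \in J).
    rewrite (bigD1 [set i]%SET) ?finset.sub1set//= !ffunE eqxx mulr1.
    rewrite big1 ?addr0.
      by case: eqP => [->|]; rewrite ?mulr1 ?mulr0.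
    by move=> S /andP[_ Si]; rewrite ffunE (negbTE Si) mulr0 mul0r.
  apply: big1 => S SJ; rewrite ffunE.
  case: eqP => [Si|]; last by rewrite mulr0 mul0r.
  by move: SJ; rewrite Si finset.sub1set (negbTE iJ).
have [iI|iI] := boolP (i \in I).
  rewrite ffunE; case: ifP => // /andP[_ /eqP e].
  by move: iI; rewrite -e !inE eqxx.
rewrite !ffunE; have -> : (i \in J) && (J :\ i == I)%SET = (J == i |: I)%SET.
  apply/andP/eqP => [[iJ /eqP <-]|->]; first by rewrite finset.setD1K.
  by rewrite !inE eqxx; split => //; rewrite finset.setU1K.
case: eqP => _; last by rewrite [RHS]mulr0.
rewrite [RHS]mulr1; congr (_ ^+ _).
rewrite -[RHS](@card_imset _ _ (fun j => (i, j))); last by move=> j k [].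
apply: eq_card => -[j k]; rewrite !inE /=; apply/and3P/imsetP.
  by move=> [/eqP -> kI ki]; exists k; rewrite ?inE ?kI.
by move=> [l]; rewrite !inE => /andP[lI li] [-> ->].
Qed.

(** Laplace expansion along the column s; the minors are again determinants of
    column selections, which is how a q-form is evaluated through
    (q-1)-forms. *)
Lemma det_colsub_expand k (g : 'I_k.+1 -> 'I_m) (s : 'I_k.+1)
    (V : 'M[R]_(k.+1, m)) :
  \det (colsub g V) =
  \sum_(r < k.+1) (-1) ^+ (r + s) * V r (g s) *
    \det (colsub (g \o lift s) (row' r V)).
Proof.
rewrite (expand_det_col _ s); apply: eq_bigr => r _.
rewrite mxE mulrCA mulrA /cofactor; congr (_ * \det _).
by apply/matrixP => x y; rewrite !mxE.
Qed.

(** For b = dx_I with i outside I, let h list i |: I increasingly and let s be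
    the position of i. The sign of the shuffle sorting i into I is (-1)^s, and
    expanding along the column s the determinant defining the left-hand side
    produces this same sign, with h \o lift s listing I. If i belongs to I, the
    right-hand side is the expansion of a determinant with the column i
    repeated. *)
Lemma ext_eval_wedge k i b (V : 'M[R]_(k.+1, m)) :
  ext_eval (wedge (dxs R [set i]%SET) b) V =
  \sum_(r < k.+1) (-1) ^+ r * V r i * ext_eval b (row' r V).
Proof.
rewrite wedge_dxs_suml ext_eval_sum.
transitivity (\sum_I b I *
    \sum_(r < k.+1) (-1) ^+ r * V r i * ext_eval (dxs R I) (row' r V)).
  2: {
  under eq_bigr do rewrite mulr_sumr.
  rewrite exchange_big/=; apply: eq_bigr => r _.
  rewrite {2}(extalg_dxs b) ext_eval_sum mulr_sumr; apply: eq_bigr => I _.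
  by rewrite mulrCA. }
apply: eq_bigr => I _; congr (_ * _); rewrite wedge_dxs.
have [Ik|Ik] := eqVneq #|I| k; last first.
  rewrite [RHS]big1 => [|r _]; last first.
    by rewrite ext_eval_dxs_deg ?mulr0//; exact/eqP.
  have [iI|iI] := boolP (i \in I).
    by rewrite /ext_eval big1// => f _; rewrite ffunE mul0r.
  rewrite ext_evalZ ext_eval_dxs_deg ?mulr0// cardsU1 iI => -[/eqP].
  exact/negP.
have [f fI fE] := increasing_ex Ik.
have dI (W : 'M[R]_(k, m)) : ext_eval (dxs R I) W = \det (colsub f W).
  by rewrite -fE ext_eval_dxs.
rewrite [RHS](eq_bigr _ (fun r _ => congr1 _ (dI _))).
have [iI|iI] := boolP (i \in I).
  have /imsetP[t _ it] : i \in [set f j | j : 'I_k]%SET by rewrite fE.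
  (* g lists i, then I in increasing order: the column i occurs twice. *)
  pose g j := oapp f i (unlift (@ord0 k) j).
  have g0 : g ord0 = i by rewrite /g unlift_none.
  have gl j : g (lift ord0 j) = f j by rewrite /g liftK.
  rewrite /ext_eval [LHS]big1 => [|h _]; last by rewrite ffunE mul0r.
  transitivity (\det (colsub g V)).
    rewrite -det_tr (determinant_alternate (i1 := ord0) (i2 := lift ord0 t))//.
    by move=> j; rewrite !mxE g0 gl -it.
  rewrite (det_colsub_expand _ ord0); apply: eq_bigr => r _.
  rewrite g0 addn0; congr (_ * \det _).
  by apply/matrixP => x y; rewrite !mxE /= gl.
have [|h hI hE] := @increasing_ex k.+1 (i |: I)%SET.
  by rewrite cardsU1 iI Ik.
have /imsetP[s _ is_] : i \in [set h j | j : 'I_k.+1]%SET.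
  by rewrite hE !inE eqxx.
have hlt x y : (h x < h y)%N = (x < y)%N.
  move/increasingP: (hI) => hh; have [/hh//|/hh/ltnW|/val_inj->] := ltngtP x y.
    by rewrite leqNgt => /negbTE.
  by rewrite ltnn.
have hlI : increasing [ffun j => h (lift s j)].
  move/increasingP: hI => hI; apply/increasingP => x y xy.
  by rewrite !ffunE; apply: hI; rewrite /= ltnNge leq_bump2 -ltnNge.
have hlE : [set [ffun j => h (lift s j)] j | j : 'I_k]%SET = I.
  apply/setP => x; apply/imsetP/idP => [[j _ ->]|xI].
    have : h (lift s j) \in i |: I by rewrite -hE imset_f.
    rewrite ffunE !inE is_ => /predU1P[/(increasing_inj hI)/eqP|//].
    by rewrite eq_sym (negbTE (neq_lift _ _)).
  have /imsetP[j _ xj] : x \in [set h j | j : 'I_k.+1]%SET.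
    by rewrite hE !inE xI orbT.
  have [j' jE|js] := unliftP s j; last by move: iI; rewrite is_ -js -xj xI.
  by exists j'; rewrite // ffunE -jE -xj.
have -> : f = [ffun j => h (lift s j)].
  by apply: increasing_uniq => //; rewrite fE hlE.
have -> : #|[set j in I | (j < i)%N]%SET| = s.
  transitivity #|[set h j | j : 'I_k.+1 & (j < s)%N]%SET|.
    apply: eq_card => x; rewrite !inE; apply/andP/imsetP.
      move=> [xI xi]; have /imsetP[j _ xj] : x \in [set h j | j : 'I_k.+1]%SET.
        by rewrite hE !inE xI orbT.
      by exists j; rewrite // inE -hlt -xj -is_.
    move=> [j]; rewrite inE => js ->; rewrite is_ hlt; split=> //.
    have : h j \in i |: I by rewrite -hE imset_f.
    by rewrite !inE is_ (inj_eq (increasing_inj hI)) -val_eqE ltn_eqF.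
  rewrite card_imset ?card_ord; last exact: increasing_inj.
  have := big_ord_widen k.+1 (fun=> 1%N) (ltnW (ltn_ord s)).
  move=> /(_ 0%N addn) wE; rewrite -sum1dep_card -wE.
  by rewrite big_const_ord iter_addn_0 mul1n.
rewrite -hE ext_evalZ ext_eval_dxs// (det_colsub_expand _ s) mulr_sumr.
apply: eq_bigr => r _; rewrite -is_ exprD mulrA.
rewrite [(_ ^+ r * _ ^+ s)]mulrC !mulrA -expr2 sqrr_sign mul1r.
congr (_ * \det _).
by apply/matrixP => x y; rewrite !mxE ffunE.
Qed.

End Evaluation.

(** * Continuously differentiable functions and strict derivatives *)
Section ContinuouslyDifferentiable.
Variables (R : realType) (m : nat).
Local Notation V := 'rV[R]_m.
Implicit Types (f g : V -> R) (x y v : V).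

Lemma is_derive_line f v y t : derivable f (t *: v + y) v ->
  is_derive t 1 (fun s : R => f (s *: v + y)) ('D_v f (t *: v + y)).
Proof.
move=> df; have E : (fun h : R => h^-1 *: (((fun s : R => f (s *: v + y)) \o
    shift t) (h *: 1) - f (t *: v + y))) =
  (fun h => h^-1 *: ((f \o shift (t *: v + y)) (h *: v) - f (t *: v + y))).
  by apply/funext => h /=; rewrite [h *: 1]mulr1 scalerDl addrA.
by apply: DeriveDef; rewrite /derivable /derive /= E.
Qed.

(** Written with absolute values so that h may have either sign: the strict
    derivative below is then taken along full neighborhoods of 0. *)
Lemma mvt_line f v y (h : R) : (forall x, derivable f x v) ->
  exists2 s : R, `|s| <= `|h| & f (y + h *: v) - f y = h * 'D_v f (y + s *: v).
Proof.
move=> df; pose phi (s : R) := f (s *: v + y).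
have dphi (s : R) : is_derive s 1 phi ('D_v f (s *: v + y)).
  exact: is_derive_line.
have cphi A : {within A, continuous phi}.
  apply: continuous_subspaceT => s.
  exact/differentiable_continuous/derivable1_diffP.
have [h0|h0] := leP 0 h.
  have [//|s] := @MVT_segment _ phi (fun s => 'D_v f (s *: v + y)) 0 h h0.
    move=> /[!in_itv]/= /andP[s0 sh]; rewrite /phi scale0r add0r subr0 => E.
  by exists s; rewrite ?ger0_norm// ![y + _]addrC E mulrC.
have [//|s] := @MVT_segment _ phi (fun s => 'D_v f (s *: v + y)) h 0 (ltW h0).
  move=> /[!in_itv]/= /andP[s0 sh]; rewrite /phi scale0r add0r sub0r => E.
exists s; first by rewrite !ler0_norm ?lerN2// ltW.
by rewrite ![y + _]addrC -opprB E mulrN opprK mulrC.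
Qed.

(** The base point y of the difference quotient moves too. This uniformity is
    what makes derivatives along different vectors add up without Frechet
    differentials, and what compactness turns into uniformity over a cube. *)
Definition strict_derive f v l x := forall e : R, 0 < e ->
  \forall y \near x & h \near (0 : R),
    `|f (y + h *: v) - f y - h * l| <= e * `|h|.

Lemma strict_derive0 f x : strict_derive f 0 0 x.
Proof.
move=> e e0; near=> y h.
by rewrite scaler0 addr0 subrr mulr0 subr0 normr0 mulr_ge0// ltW.
Unshelve. all: by end_near. Qed.

(** Going first along v and then along w, the second difference is based at
    y + h v, which still tends to x. *)
Lemma strict_deriveD f v w k l x :
  strict_derive f v k x -> strict_derive f w l x ->
  strict_derive f (v + w) (k + l) x.
Proof.
move=> fv fw e e0; have e20 : 0 < e / 2 by rewrite divr_gt0.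
have cc : (fun z : V * R => (z.1 + z.2 *: v, z.2)) @
    filter_prod (nbhs x) (nbhs (0 : R)) -->
    filter_prod (nbhs x) (nbhs (0 : R)).
  apply: (@cvg_pair _ _ _ _ (nbhs x) (nbhs (0 : R))); last exact: cvg_snd.
  rewrite -[X in _ --> nbhs X]addr0 -(scale0r v).
  by apply: cvgD; [exact: cvg_fst|apply: cvgZr_tmp; exact: cvg_snd].
have fw' : \forall y \near x & h \near (0 : R),
    `|f (y + h *: v + h *: w) - f (y + h *: v) - h * l| <= e / 2 * `|h|.
  exact: cc _ (fw _ e20).
pose F := filter_prod (nbhs x) (nbhs (0 : R)).
apply: (@filterS2 _ F _ _ _ _ _ (fv _ e20) fw') => -[y h] /= hv hw.
rewrite scalerDr addrA mulrDr [e]splitr mulrDl.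
apply: le_trans (lerD hw hv).
rewrite (le_trans _ (ler_normD _ _))// le_eqVlt; apply/predU1l.
by congr `|_|; ring.
Qed.

Lemma strict_deriveZ f v l t x :
  strict_derive f v l x -> strict_derive f (t *: v) (t * l) x.
Proof.
move=> fv e e0; have t0 : 0 < `|t| + 1 by rewrite ltr_wpDl.
have cc : (fun z : V * R => (z.1, t * z.2)) @
    filter_prod (nbhs x) (nbhs (0 : R)) -->
    filter_prod (nbhs x) (nbhs (0 : R)).
  apply: (@cvg_pair _ _ _ _ (nbhs x) (nbhs (0 : R))); first exact: cvg_fst.
  rewrite -[X in _ --> nbhs X](mulr0 t).
  by apply: cvgM; [exact: cvg_cst|exact: cvg_snd].
pose F := filter_prod (nbhs x) (nbhs (0 : R)).
apply: (@filterS _ F _ _ _ _ (cc _ (fv _ (divr_gt0 e0 t0)))) => -[y h] /=.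
rewrite scalerA mulrCA mulrA (mulrC h t) normrM.
move=> /le_trans; apply; rewrite mulrA ler_wpM2r//.
by rewrite mulrAC ler_pdivrMr// ler_pM2l// lerDl.
Qed.

Lemma strict_derive_axis f v x :
  (forall y, derivable f y v) -> {for x, continuous ('D_v f)} ->
  strict_derive f v ('D_v f x) x.
Proof.
move=> df cf e e0.
have /cvgrPdist_le/(_ e e0) := cf; rewrite -[nbhs _]/(nbhs x).
move=> /nbhs_ballP[d /= d0 xd].
have v0 : 0 < `|v| + 1 by rewrite ltr_wpDl.
near=> y h.
have [s sh ->] := mvt_line y h df.
rewrite -mulrBr normrM mulrC ler_wpM2r// distrC; apply: xd.
rewrite -ball_normE /ball_/= opprD addrA (le_lt_trans (ler_normB _ _))//.
rewrite [d]splitr ltrD//.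
  by near: y; apply: cvgr_dist_lt => //; rewrite divr_gt0.
rewrite normrZ (@le_lt_trans _ _ (`|h| * (`|v| + 1)))//.
  by rewrite ler_pM// lerDl.
rewrite -ltr_pdivlMr//; near: h.
have d' : 0 < d / 2 / (`|v| + 1) by rewrite !divr_gt0.
exact: (@nbhs0_lt _ R _ d').
Unshelve. all: by end_near. Qed.

(** Continuous together with its first partial derivatives; the existence of the
    partials is demanded separately because 'D is total. *)
Definition C1 f := continuous f /\
  forall i : 'I_m, (forall x, derivable f x (delta_mx 0 i)) /\
    continuous (partial i f).

Lemma continuous_sum (I : finType) (F : I -> V -> R) :
  (forall i, continuous (F i)) -> continuous (fun x => \sum_i F i x).
Proof.
move=> cF; rewrite (_ : (fun _ => _) = \sum_i F i).
  elim/big_ind : _ => // [|f g cf cg x]; first exact: cst_continuous.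
  exact: cvgD (cf x) (cg x).
by apply/funext => x; rewrite fct_sumE.
Qed.

Lemma strict_derive_C1 f v x : C1 f ->
  strict_derive f v (\sum_i v 0 i * partial i f x) x.
Proof.
move=> [_ f1]; rewrite {1}[v]row_sum_delta.
elim/big_ind2 : _ => [|v1 l1 v2 l2|i _].
- exact: strict_derive0.
- exact: strict_deriveD.
- have [df cf] := f1 i.
  by apply: strict_deriveZ; apply: strict_derive_axis => //; exact: cf.
Qed.

Lemma C1_cst (c : R) : C1 (fun=> c).
Proof.
split=> [|i]; first exact: cst_continuous.
split=> [x|]; first exact: derivable_cst.
rewrite (_ : partial _ _ = fun=> 0); first exact: cst_continuous.
by apply/funext => x; exact: derive_cst.
Qed.

Lemma C1D f g : C1 f -> C1 g -> C1 (fun x => f x + g x).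
Proof.
move=> [cf f1] [cg g1]; split=> [x|i]; first exact: cvgD (cf x) (cg x).
have [[df pf] [dg pg]] := (f1 i, g1 i).
split=> [x|]; first exact: derivableD.
rewrite (_ : partial _ _ = fun x => partial i f x + partial i g x).
  by move=> x; exact: cvgD (pf x) (pg x).
by apply/funext => x; exact: deriveD.
Qed.

Lemma C1M f g : C1 f -> C1 g -> C1 (fun x => f x * g x).
Proof.
move=> [cf f1] [cg g1]; split=> [x|i]; first exact: cvgM (cf x) (cg x).
have [[df pf] [dg pg]] := (f1 i, g1 i).
split=> [x|]; first exact: derivableM.
rewrite (_ : partial _ _ =
    fun x => f x * partial i g x + g x * partial i f x).
  by move=> x; exact: (cvgD (cvgM (cf x) (pg x)) (cvgM (cg x) (pf x))).
by apply/funext => x; exact: deriveM.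
Qed.

Lemma C1N (f : V -> R) : C1 f -> C1 (fun x => - f x).
Proof.
move=> Cf; rewrite (_ : (fun _ => _) = (fun x => -1 * f x)).
  by apply: C1M => //; exact: C1_cst.
by apply/funext => x; rewrite mulN1r.
Qed.

Lemma C1_sum (I : Type) (r : seq I) (P : pred I) (F : I -> V -> R) :
  (forall i, P i -> C1 (F i)) -> C1 (fun x => \sum_(i <- r | P i) F i x).
Proof.
move=> CF; rewrite (_ : (fun _ => _) = \sum_(i <- r | P i) F i).
  by elim/big_ind : _ => //; [exact: C1_cst|exact: C1D].
by apply/funext => x; rewrite fct_sumE.
Qed.

(** Partial derivatives are derivatives along lines, so the one-variable chain
    rule suffices. *)
Lemma C1_comp (phi dphi : R -> R) f : C1 f ->
  (forall x, is_derive (f x) 1 phi (dphi (f x))) ->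
  (forall x, {for f x, continuous dphi}) -> C1 (fun x => phi (f x)).
Proof.
move=> [cf f1] dp cp.
have cphi x : {for f x, continuous phi}.
  by apply/differentiable_continuous/derivable1_diffP; have [] := dp x.
have dcomp (i : 'I_m) x : is_derive x (delta_mx 0 i) (fun x => phi (f x))
    (dphi (f x) * partial i f x).
  have [df _] := f1 i.
  have dl : is_derive (0 : R) 1 (fun s : R => f (s *: delta_mx 0 i + x))
      (partial i f x).
    have := @is_derive_line f (delta_mx 0 i) x 0.
    by rewrite scale0r add0r; apply.
  have dpl : is_derive (f (0 *: delta_mx 0 i + x)) 1 phi (dphi (f x)).
    by rewrite scale0r add0r.
  have := @is_derive1_comp _ phi (fun s : R => f (s *: delta_mx 0 i + x)) 0
    _ _ dpl dl.
  move=> [d1 d2].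
  apply: (@DeriveDef _ _ _ x (delta_mx 0 i) (fun x => phi (f x))).
    exact: (derivable1P (fun x => phi (f x)) _ _).2 d1.
  rewrite -d2 /derive; apply: (congr1 (fun q : R -> R => lim (q @ (0 : R)^'))).
  apply/funext => h /=.
  by rewrite addr0 scale0r add0r [h *: 1]mulr1.
split=> [x|i]; first exact: (continuous_comp (cf x) (cphi x)).
split=> [x|]; first by have [] := dcomp i x.
rewrite (_ : partial _ _ = fun x => dphi (f x) * partial i f x).
  move=> x; have cpx := continuous_comp (cf x) (cp x).
  exact: (cvgM cpx ((f1 i).2 x)).
by apply/funext => x; have [_ <-] := dcomp i x.
Qed.

Lemma C1_invr f : (forall x, f x != 0) -> C1 f -> C1 (fun x => (f x)^-1).
Proof.
move=> f0 Cf; apply: (@C1_comp GRing.inv (fun t => - t ^- 2)) => // x.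
  have := @is_deriveV _ id (f x) 1 1 (f0 x) (is_derive_id _ _).
  by rewrite [_ *: 1]mulr1.
by apply: cvgN; apply: cvgV; [rewrite expf_neq0|exact: exprn_continuous].
Qed.

Lemma C1_sqrt f : (forall x, 0 < f x) -> C1 f -> C1 (fun x => Num.sqrt (f x)).
Proof.
move=> f0 Cf.
apply: (@C1_comp Num.sqrt (fun t => (2 * Num.sqrt t)^-1)) => // x.
  exact: is_derive1_sqrt.
apply: cvgV; first by rewrite mulf_neq0// gt_eqF// sqrtr_gt0.
by apply: cvgM; [exact: cvg_cst|exact: sqrt_continuous].
Qed.

Lemma smooth_C1 f : smooth f -> C1 f.
Proof.
move=> sf; split; first exact: (sf [::]).1.
move=> i; split; first exact: (sf [::]).2.
exact: (sf [:: i]).1.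
Qed.

Lemma smooth_partial i f : smooth f -> smooth (partial i f).
Proof. by move=> sf s; have := sf (rcons s i); rewrite foldr_rcons. Qed.

End ContinuouslyDifferentiable.

(** * A discrete divergence theorem *)
Section DiscreteStokes.
Variable R : realType.

Lemma card_grid_face q N (r : 'I_q) (i : 'I_N) :
  (\sum_(k : {ffun 'I_q -> 'I_N}) (k r == i) = N ^ q.-1)%N.
Proof.
pose F (j : 'I_q) (l : 'I_N) : nat :=
  if j == r then nat_of_bool (l == i) else 1%N.
transitivity (\sum_(k : {ffun 'I_q -> 'I_N}) \prod_j F j (k j))%N.
  apply: eq_bigr => k _; rewrite (bigD1 r)//= /F eqxx big1 ?muln1// => j jr.
  by rewrite (negbTE jr).
rewrite -bigA_distr_bigA (bigD1 r)//= {1}/F eqxx (bigD1 i)//= eqxx.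
rewrite big1 => [|l li].
  rewrite mul1n (eq_bigr (fun=> N)) => [|j jr].
    by rewrite prod_nat_const cardC1 card_ord.
  by rewrite /F (negbTE jr) sum_nat_const card_ord muln1.
by rewrite (negbTE li).
Qed.

(** Shifting the coordinate r cyclically permutes the grid. After reindexing the
    subtracted sum by this shift, all terms cancel except those of the last
    face, where the cyclic shift wraps around instead of leaving the grid. *)
Lemma grid_telescope q N (H : ('I_q -> nat) -> R) (C : R) (r : 'I_q) :
  (forall k, `|H k| <= C) ->
  \sum_(k : {ffun 'I_q -> 'I_N.+1})
    (H (fun j => k j + (j == r))%N - H (fun j => k j)) <=
  2 * C * (N.+1 ^ q.-1)%:R.
Proof.
move=> HC; rewrite big_split/= sumrN.
pose s (k : {ffun 'I_q -> 'I_N.+1}) :=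
  [ffun j => if j == r then ordS (k j) else k j].
have s_inj : injective s.
  move=> k l /ffunP kl; apply/ffunP => j; have := kl j; rewrite !ffunE.
  by case: ifP => // _; exact: ordS_inj.
rewrite [X in _ - X](reindex_inj s_inj)/= -sumrB.
rewrite -(card_grid_face r (@ord_max N)) natr_sum mulr_sumr.
apply: ler_sum => k _; have [krN|krN] := eqVneq (k r) ord_max.
  rewrite mulr1 mulr_natl mulr2n (le_trans (ler_norm _))//.
  by rewrite (le_trans (ler_normB _ _))// lerD.
rewrite mulr0 subr_le0 le_eqVlt; apply/predU1l; congr H; apply/funext => j.
rewrite ffunE; case: eqP => [->|]; last by rewrite addn0.
rewrite addn1 /= modn_small// ltnS ltn_neqAle -ltnS ltn_ord andbT.
by move: krN; rewrite -val_eqE.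
Qed.

Variable m : nat.
Local Notation V := 'rV[R]_m.

Lemma affine_continuous q (x0 : V) (E : 'M[R]_(q, m)) :
  continuous (fun u : 'rV[R]_q => x0 + u *m E).
Proof.
have -> : (fun u : 'rV[R]_q => x0 + u *m E) =
    (fun u : 'rV[R]_q => x0 + \sum_r u 0 r *: row r E).
  by apply/funext => u; rewrite mulmx_sum_row.
move=> u; apply: (@cvgD _ _ _ (nbhs u) _ (fun=> x0)); first exact: cvg_cst.
apply: cvg_big => [|r _]; first exact: add_continuous.
by apply: cvgZr_tmp; exact: coord_continuous.
Qed.

Definition divergence q (E : 'M[R]_(q, m)) (F : 'I_q -> V -> R) x :=
  \sum_r \sum_i E r i * partial i (F r) x.

Lemma divergenceN q (E : 'M[R]_(q, m)) (F : 'I_q -> V -> R) x :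
  (forall r, C1 (F r)) ->
  divergence E (fun r y => - F r y) x = - divergence E F x.
Proof.
move=> CF; rewrite /divergence -sumrN; apply: eq_bigr => r _.
rewrite -sumrN; apply: eq_bigr => i _; rewrite -mulrN; congr (_ * _).
by apply: deriveN; have [] := (CF r).2 i.
Qed.

Definition cube q (L : R) : set 'rV[R]_q :=
  [set u : 'rV[R]_q | forall r, 0 <= u ord0 r <= L].

Lemma cube_compact q L : compact (@cube q L).
Proof.
exact: (@rV_compact R q (fun=> `[0, L]%classic) (fun=> @segment_compact _ _ _)).
Qed.

(** Strict differentiability gives the estimate for all y near x and h near 0;
    compactness, in the form of near covering, makes the bound on h uniform. *)
Lemma uniform_flux q (E : 'M[R]_(q, m)) (F : 'I_q -> V -> R) (A : set V)
    (c : R) :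
  (forall r, C1 (F r)) -> compact A ->
  (forall x, A x -> c < divergence E F x) ->
  \forall h \near (0 : R), forall y, A y -> 0 < h ->
    h * c <= \sum_r (F r (y + h *: row r E) - F r y).
Proof.
move=> CF cA divA.
apply: ((compact_near_coveringP A).1 cA R (nbhs (0 : R)) (fun h y => 0 < h ->
  h * c <= \sum_r (F r (y + h *: row r E) - F r y))) => x Ax.
have q0 : 0 < q%:R + 1 :> R by rewrite ltr_wpDl.
pose l r := \sum_i E r i * partial i (F r) x.
(* The q errors e h add up to less than h (divergence - c); the extra 1 covers
   q = 0. *)
pose e := (divergence E F x - c) / (q%:R + 1).
have e0 : 0 < e by rewrite divr_gt0// subr_gt0 divA.
have : filter_prod (nbhs x) (nbhs (0 : R)) [set z | forall r,
    `|F r (z.1 + z.2 *: row r E) - F r z.1 - z.2 * l r| <= e * `|z.2|].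
  apply: (@filter_forall (V * R)%type 'I_q (fun r z =>
    `|F r (z.1 + z.2 *: row r E) - F r z.1 - z.2 * l r| <= e * `|z.2|)
    (filter_prod (nbhs x) (nbhs (0 : R))) _) => r.
  have -> : l r = \sum_i (row r E) 0 i * partial i (F r) x.
    by apply: eq_bigr => i _; rewrite mxE.
  exact: strict_derive_C1.
apply: (@filterS _ (filter_prod (nbhs x) (nbhs (0 : R)))) => -[y h] /= Fl h0.
have -> : h * c = h * divergence E F x - e * h * (q%:R + 1).
  by rewrite /e; field; rewrite gt_eqF.
have Fs : \sum_r (h * l r - e * h) <=
    \sum_r (F r (y + h *: row r E) - F r y).
  apply: ler_sum => r _; have := Fl r; rewrite (gtr0_norm h0) ler_norml.
  by move=> /andP[+ _]; rewrite lerBrDl addrC.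
apply: le_trans Fs; rewrite sumrB -mulr_sumr sumr_const card_ord.
by rewrite -(mulr_natr (e * h)) lerB// ler_wpM2l ?lerDl// mulr_ge0// ltW.
Qed.

(** The sum of the differences over the grid of step h = L / n is at least
    n^q h c and at most q times 2 C n^(q-1); divide by n^(q-1). *)
Lemma flux_bound q (E : 'M[R]_(q.+1, m)) (F : 'I_q.+1 -> V -> R) x0
    (L C c : R) :
  (forall r, C1 (F r)) -> (forall r x, `|F r x| <= C) -> 0 < L ->
  (forall u, cube L u -> c < divergence E F (x0 + u *m E)) ->
  L * c <= 2 * C * q.+1%:R.
Proof.
move=> CF FC L0 divc.
pose A := [set x0 + u *m E | u in @cube q.+1 L].
have cA : compact A.
  apply: continuous_compact; last exact: cube_compact.
  by apply: continuous_subspaceT => u; exact: affine_continuous.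
have /nbhs_ballP[d /= d0 hd] : \forall h \near (0 : R),
    forall y, A y -> 0 < h -> h * c <= \sum_r (F r (y + h *: row r E) - F r y).
  by apply: uniform_flux => // _ [u uL <-]; exact: divc.
(* N.+1 exceeds L / d, so that the step h is below d. *)
pose N := Num.truncn (L / d); pose h := L / N.+1%:R.
have h0 : 0 < h by rewrite divr_gt0.
have hA : forall y, A y -> h * c <= \sum_r (F r (y + h *: row r E) - F r y).
  move=> y Ay; apply: hd => //; rewrite /ball /= sub0r normrN gtr0_norm//.
  by rewrite ltr_pdivrMr// mulrC -ltr_pdivrMr// truncnS_gt.
pose pt (k : 'I_q.+1 -> nat) := x0 + (\row_j (h * (k j)%:R)) *m E.
have ptA (k : {ffun 'I_q.+1 -> 'I_N.+1}) : A (pt (fun j => k j)).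
  exists (\row_j (h * (k j)%:R)) => // r; rewrite mxE; apply/andP; split.
    by rewrite mulr_ge0// ltW.
  rewrite /h mulrAC ler_pdivrMr// ler_wpM2l ?ler_nat ?(ltW L0)//.
  exact/ltnW/ltn_ord.
have ptS k r : pt (fun j => k j + (j == r))%N = pt k + h *: row r E.
  rewrite /pt -addrA; congr (_ + _); rewrite rowE scalemxAl -mulmxDl.
  congr (_ *m _); apply/rowP => j; rewrite !mxE eqxx/=.
  by rewrite natrD mulrDr.
have : \sum_(k : {ffun 'I_q.+1 -> 'I_N.+1}) (h * c) <=
    \sum_(r < q.+1) 2 * C * (N.+1 ^ q)%:R.
  rewrite (le_trans (ler_sum _ (fun k _ => hA _ (ptA k))))//.
  rewrite exchange_big/=; apply: ler_sum => r _.
  under eq_bigr do rewrite -ptS.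
  exact: (@grid_telescope q.+1 N (fun k => F r (pt k))).
have N0 : 0 < (N.+1 ^ q)%:R :> R by rewrite ltr0n expn_gt0.
rewrite [X in X <= _](_ : _ = h * c * (N.+1 ^ q * N.+1)%:R); last first.
  by rewrite sumr_const card_ffun !card_ord -[LHS]mulr_natr expnSr.
rewrite sumr_const card_ord -[X in _ <= X]mulr_natr natrM.
move=> NB; rewrite -(ler_pM2r N0); apply: le_trans (le_trans _ NB) _.
  rewrite le_eqVlt; apply/predU1l; rewrite /h.
  have : N.+1%:R != 0 :> R by rewrite pnatr_eq0.
  by move: N.+1%:R (_ ^ _)%:R => n M n0; field.
by rewrite le_eqVlt; apply/predU1l; ring.
Qed.

(** Between points where H has opposite signs, the intermediate value theorem on
    a segment, which stays in the cube, would give a zero. *)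
Lemma sign_constant q (H : 'rV[R]_q -> R) (L c : R) : continuous H -> 0 < c ->
  (forall u, cube L u -> c <= `|H u|) -> 0 <= H 0 ->
  forall u, cube L u -> c <= H u.
Proof.
move=> cH c0 cle H0 u uL; have := cle u uL.
have [Hu|Hu] := leP 0 (H u); first by rewrite ger0_norm.
pose phi (t : R) := H (t *: u).
have cphi : {within `[0, 1], continuous phi}.
  apply: continuous_subspaceT => t; apply: continuous_comp; last exact: cH.
  by apply: cvgZr_tmp; exact: cvg_id.
have [|t] := @IVT R phi 0 1 0 ler01 cphi.
  by rewrite /phi scale0r scale1r ge_min le_max H0 (ltW Hu) orbT.
rewrite in_itv/= => /andP[t0 t1] Ht.
have tL : cube L (t *: u).
  move=> r; have /andP[u0 u1] := uL r; rewrite mxE mulr_ge0//=.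
  by rewrite (le_trans _ u1)// ler_piMl.
by have := cle _ tL; rewrite -/(phi t) Ht normr0 leNgt c0.
Qed.

End DiscreteStokes.

(** * The exterior derivative as a divergence on a plane *)
Section PlaneDivergence.
Variables (R : realType) (m : nat).
Local Notation V := 'rV[R]_m.

Lemma partial_ext_eval k (eta : dform R m) (W : 'M[R]_(k, m)) x (i : 'I_m) :
  (forall J, C1 (fun y => eta y J)) ->
  partial i (fun y => ext_eval (eta y) W) x =
  ext_eval [ffun J => partial i (fun y => eta y J) x] W.
Proof.
move=> Ceta.
suff : is_derive x (delta_mx 0 i) (fun y => ext_eval (eta y) W)
    (ext_eval [ffun J => partial i (fun y => eta y J) x] W) by case.
rewrite /ext_eval (_ : (fun y : V => _) =
    \sum_(f : {ffun 'I_k -> 'I_m} | increasing f)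
      (fun y => eta y [set f i | i : 'I_k]%SET * \det (colsub f W))).
  2: by apply/funext => y; rewrite fct_sumE.
elim/big_ind2 : _ => [|? ? ? ? |f _].
- exact: is_derive_cst.
- exact: is_deriveD.
- set J := [set f i | i : 'I_k]%SET; rewrite ffunE.
  have [df _] := (Ceta J).2 i.
  have := is_deriveM (derivableP (df x))
    (is_derive_cst (\det (colsub f W)) x (delta_mx 0 i)).
  by rewrite scaler0 add0r [_ *: _]mulrC.
Qed.

Lemma C1_ext_eval k (eta : dform R m) (W : 'M[R]_(k, m)) :
  (forall J, C1 (fun y => eta y J)) -> C1 (fun y => ext_eval (eta y) W).
Proof.
by move=> Ceta; apply: C1_sum => f _; apply: C1M => //; exact: C1_cst.
Qed.

Lemma ext_eval_ext_d q (eta : dform R m) (E : 'M[R]_(q.+1, m)) x :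
  (forall J, C1 (fun y => eta y J)) ->
  ext_eval (ext_d eta x) E =
  divergence E (fun r y => (-1) ^+ r * ext_eval (eta y) (row' r E)) x.
Proof.
move=> Ceta; rewrite /divergence exchange_big /ext_d /=.
rewrite -(eq_bigr _ (fun i _ => scale1r _)) ext_eval_sum; apply: eq_bigr => i _.
rewrite mul1r ext_eval_wedge; apply: eq_bigr => r _.
rewrite -partial_ext_eval// -mulrA mulrCA; congr (_ * _).
by apply/esym/deriveMl; have [] := (C1_ext_eval (row' r E) Ceta).2 i.
Qed.

Lemma ext_eval_bound k (a : extalg R m) (W : 'M[R]_(k, m)) :
  (forall J, `|a J| <= 1) ->
  `|ext_eval a W| <= \sum_(f : {ffun 'I_k -> 'I_m}) `|\det (colsub f W)|.
Proof.
move=> a1; rewrite (le_trans (ler_norm_sum _ _ _))//.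
rewrite [leRHS](bigID (fun f => increasing f))/= ler_wpDr ?sumr_ge0//.
by apply: ler_sum => f _; rewrite normrM ler_piMl.
Qed.

(** The half-space u_0 >= T contains cubes of every side L. If d eta stayed at
    least c in absolute value there, it would keep a sign on the cube with
    corner T e_0, and flux_bound, applied with c / 2, would bound L. *)
Lemma no_bounded_primitive q (eta : dform R m) (E : 'M[R]_(q.+1, m)) (a : V)
    (T c : R) :
  (forall J, C1 (fun y => eta y J)) -> (forall y J, `|eta y J| <= 1) -> 0 < c ->
  exists2 u : 'rV[R]_q.+1, T <= u 0 0 &
    `|ext_eval (ext_d eta (a + u *m E)) E| < c.
Proof.
move=> Ceta eta1 c0; apply: contrapT => noex.
have cle (u : 'rV[R]_q.+1) : T <= u 0 0 ->
    c <= `|ext_eval (ext_d eta (a + u *m E)) E|.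
  by move=> Tu; rewrite leNgt; apply/negP => uc; apply: noex; exists u.
pose F (r : 'I_q.+1) y := (-1) ^+ r * ext_eval (eta y) (row' r E).
have CF r : C1 (F r) by apply: C1M; [exact: C1_cst|exact: C1_ext_eval].
pose B := \sum_(r < q.+1) \sum_(f : {ffun 'I_q -> 'I_m})
  `|\det (colsub f (row' r E))|.
have B0 : 0 <= B by apply: sumr_ge0 => r _; exact: sumr_ge0.
have FB r x : `|F r x| <= B.
  rewrite normrM normrX normrN1 expr1n mul1r.
  rewrite (le_trans (ext_eval_bound _ (eta1 x)))//.
  by rewrite /B (bigD1 r)//= lerDl sumr_ge0// => s _; exact: sumr_ge0.
pose x0 : V := a + (T *: delta_mx 0 0) *m E.
(* With this side, L (c / 2) = 2 B q.+1 + 1. *)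
pose L : R := (4 * B * q.+1%:R + 2) / c.
have L0 : 0 < L by rewrite divr_gt0// ltr_wpDl// !mulr_ge0.
pose D (u : 'rV[R]_q.+1) := divergence E F (x0 + u *m E).
have cdiv : continuous (divergence E F).
  apply: continuous_sum => r; apply: continuous_sum => i x.
  exact: (cvgM (cvg_cst _) (((CF r).2 i).2 x)).
have cD : continuous D.
  move=> u; exact: (@continuous_comp _ _ _ (fun v : 'rV[R]_q.+1 => x0 + v *m E)
    (divergence E F) u (@affine_continuous R m _ x0 E u) (cdiv _)).
have Dc u : cube L u -> c <= `|D u|.
  move=> uL; have := cle (T *: delta_mx 0 0 + u).
  rewrite !mxE eqxx mulr1 lerDl ext_eval_ext_d// mulmxDl addrA; apply.
  by have /andP[] := uL 0.
have c2 : c / 2 < c by rewrite gtr_pMr// invf_lt1// ltr1n.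
suff : L * (c / 2) <= 2 * B * q.+1%:R.
  rewrite [L * _](_ : _ = 2 * B * q.+1%:R + 1); first by rewrite gerDl ler10.
  by rewrite /L; move: q.+1%:R => n; field; rewrite gt_eqF.
have [D0|D0] := leP 0 (D 0).
  apply: (@flux_bound _ _ _ E F x0) => // u uL.
  by rewrite (lt_le_trans c2)//; exact: (sign_constant cD c0 Dc).
apply: (@flux_bound _ _ _ E (fun r y => - F r y) x0) => //.
- by move=> r; exact: C1N.
- by move=> r x; rewrite normrN.
- move=> u uL; rewrite divergenceN// (lt_le_trans c2)//.
  apply: (@sign_constant _ _ (fun u => - D u) _ _ _ c0 _ _ _ uL).
  + by move=> v; exact: (cvgN (cD v)).
  + by move=> v vL; rewrite normrN; exact: Dc.
  + by rewrite oppr_ge0 ltW.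
Qed.

End PlaneDivergence.

(** * The nonlinear term and the conclusion *)
Section MinimalGraph.
Variables (R : realType) (m : nat).
Local Notation V := 'rV[R]_m.

Lemma ext_dot_ge0 (b : extalg R m) : 0 <= ext_dot b b.
Proof. by apply: sumr_ge0 => I _; rewrite -expr2 sqr_ge0. Qed.

Lemma ext_norm_sqr (b : extalg R m) : ext_norm b ^+ 2 = ext_dot b b.
Proof. exact: sqr_sqrtr (ext_dot_ge0 b). Qed.

Lemma C1_ext_d (w : dform R m) (J : {set 'I_m}) : smooth_form w ->
  C1 (fun y => ext_d w y J).
Proof.
move=> sw; rewrite (_ : (fun _ => _) = (fun y : V => \sum_(i < m)
    \sum_(I : {set 'I_m} | I \subset J)
      shuffle_sign R I (J :\: I) * dxs R [set i]%SET I *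
      partial i (fun z => w z (J :\: I)%SET) y)).
  apply: C1_sum => i _; apply: C1_sum => I _; apply: C1M; first exact: C1_cst.
  exact/smooth_C1/smooth_partial.
apply/funext => y; rewrite /ext_d sum_ffunE; apply: eq_bigr => i _.
by rewrite ffunE; apply: eq_bigr => I _; congr (_ * _); rewrite ffunE.
Qed.

(** For the differential b of a function, this is up to sign the horizontal part
    of the unit normal of its graph; hence the length below 1. *)
Definition normalized (b : extalg R m) : extalg R m :=
  (Num.sqrt (1 + ext_norm b ^+ 2))^-1 *: b.

Lemma norm_hodge (b : extalg R m) (J : {set 'I_m}) :
  `|hodge b J| = `|b (~: J)%SET|.
Proof. by rewrite ffunE normrM normrX normrN1 expr1n mul1r. Qed.

(** One squared coefficient is at most |b|^2, which is less than
    1 + |b|^2. *)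
Lemma normalized_le1 (b : extalg R m) (J : {set 'I_m}) :
  `|hodge (normalized b) J| <= 1.
Proof.
rewrite norm_hodge ffunE.
have s0 : 0 < 1 + ext_dot b b by rewrite ltr_pwDl// ext_dot_ge0.
rewrite ext_norm_sqr [_ *: _]mulrC normrM normfV (ger0_norm (sqrtr_ge0 _)).
rewrite ler_pdivrMr ?sqrtr_gt0// mul1r -sqrtr_sqr ler_wsqrtr// /ext_dot.
rewrite (bigD1 (~: J)%SET)//= expr2 addrCA lerDl addr_ge0//.
by apply: sumr_ge0 => I _; rewrite -expr2 sqr_ge0.
Qed.

(** The radicand is at least 1, so the square root and the inverse are taken
    where they are differentiable. *)
Lemma C1_normalized (w : dform R m) (J : {set 'I_m}) : smooth_form w ->
  C1 (fun y => hodge (normalized (ext_d w y)) J).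
Proof.
move=> sw; have Cdot : C1 (fun y => ext_dot (ext_d w y) (ext_d w y)).
  by apply: C1_sum => I _; apply: C1M; exact: C1_ext_d.
rewrite (_ : (fun _ => _) = (fun y => shuffle_sign R (~: J)%SET J *
  ((Num.sqrt (1 + ext_dot (ext_d w y) (ext_d w y)))^-1 *
    ext_d w y (~: J)%SET))).
  have s0 y : 0 < 1 + ext_dot (ext_d w y) (ext_d w y).
    by rewrite ltr_pwDl// ext_dot_ge0.
  apply: C1M; first exact: C1_cst.
  apply: C1M; last exact: C1_ext_d.
  apply: C1_invr => [y|]; first by rewrite gt_eqF// sqrtr_gt0.
  by apply: C1_sqrt => //; apply: C1D => //; exact: C1_cst.
by apply/funext => y; rewrite !ffunE ext_norm_sqr.
Qed.

Lemma coord_le_norm (x : V) j : `|x ord0 j| <= `|x|.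
Proof.
rewrite [leRHS]/Num.Def.normr /= mx_normrE; apply/bigmax_geP; right.
by exists (ord0, j).
Qed.

(** Orthonormality recovers u as (x - a) E^T from the point x = a + u E, so
    bounded points have bounded coordinates. *)
Lemma plane_coord_bound q (a : V) (E : 'M[R]_(q.+1, m)) (K : set V) :
  orthonormal_rows E -> bounded_set K ->
  exists T : R, forall u : 'rV[R]_q.+1, K (a + u *m E) -> u 0 0 < T.
Proof.
move=> EE [M [_ /(_ (M + 1))KM]].
exists (\sum_j (M + 1 + `|a|) * `|E 0 j| + 1) => u Ku.
have -> : u 0 0 = \sum_j ((a + u *m E) - a) 0 j * E 0 j.
  rewrite addrC addKr -[u in LHS]mulmx1 -EE mulmxA mxE.
  by apply: eq_bigr => j _; rewrite [E^T _ _]mxE.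
rewrite ltr_pwDr//; apply: ler_sum => j _.
rewrite (le_trans (ler_norm _))// normrM ler_wpM2r//.
rewrite (le_trans (coord_le_norm _ _))// (le_trans (ler_normB _ _))// lerD2r.
by apply: KM => //; rewrite ltrDl.
Qed.

(** The infimum is nonnegative. Were it positive, it would bound |g| from below
    on the part u_0 >= T of the plane, which avoids K; there g is the value of
    d eta on the orthonormal frame E, against no_bounded_primitive. *)
Lemma inf_abs_eq0 q (w : dform R m) (a : V) (E : 'M[R]_(q.+1, m)) (K : set V)
    (g : V -> R) :
  smooth_form w -> orthonormal_rows E -> bounded_set K ->
  (forall x, (affine_plane a E `\` K) x ->
    pullback_eq E (ext_d (fun y => hodge (normalized (ext_d w y)))) (g x) x) ->
  inf [set `|g x| | x in affine_plane a E `\` K] = 0.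
Proof.
move=> sw EE bK gE; set S := [set _ | _ in _].
have S0 : lbound S 0 by move=> _ [x _ <-].
have [->|Sn] := eqVneq S set0; first exact: inf0.
have c0 : 0 <= inf S by apply: lb_le_inf => //; exact/set0P.
apply/eqP; rewrite eq_le c0 andbT leNgt; apply/negP => c_gt0.
have [T KT] := plane_coord_bound a EE bK.
have [||u Tu] := @no_bounded_primitive R m q
  (fun y => hodge (normalized (ext_d w y))) E a T _ _ _ c_gt0.
- by move=> J; exact: C1_normalized.
- by move=> y J; exact: normalized_le1.
have xP : (affine_plane a E `\` K) (a + u *m E).
  by split; [exists u|move=> /KT; rewrite ltNge Tu].
rewrite (gE _ xP)//.
rewrite /volume_element EE det1 mulr1 ltNge => /negP; apply.
by apply: ge_inf; [exists 0|exists (a + u *m E)].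
Qed.

End MinimalGraph.

Theorem theorem9p2 (R : realType) (m p : nat) (hpm : (p < m)%N)
    (omega xi : dform R m)
    (omega_deg : forall x, of_degree p (omega x))
    (omega_smooth : smooth_form omega)
    (xi_deg : forall x, of_degree (m - p) (xi x))
    (omega_eq : forall x,
      ext_d (fun y => hodge ((Num.sqrt (1 + ext_norm (ext_d omega y) ^+ 2))^-1
                             *: ext_d omega y)) x = xi x)
    (a : 'rV[R]_m) (E : 'M[R]_(m - p, m)) (hE : orthonormal_rows E)
    (K : set 'rV[R]_m) (K_sub : K `<=` affine_plane a E)
    (K_bounded : bounded_set K)
    (g : 'rV[R]_m -> R)
    (g_cont : {within affine_plane a E `\` K, continuous g})
    (xi_plane : forall x, (affine_plane a E `\` K) x ->
      pullback_eq E xi (g x) x)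
    (c : R) (hc : c = inf [set `|g x| | x in affine_plane a E `\` K]) :
  c = 0.
Proof.
have q1 : (m - p)%N = (m - p).-1.+1 by rewrite prednK// subn_gt0.
rewrite {c}hc; clear K_sub g_cont.
move: (m - p)%N (m - p).-1 q1 E hE xi_plane => q q' qE.
rewrite {}qE => E hE xi_plane.
apply: (@inf_abs_eq0 _ _ q' omega) => // x /xi_plane h W WE.
by rewrite -h// -omega_eq.
Qed.
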